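(* Let $\Sigma\in\mathcal{G}_n$ and let $Q_0$ be the unique regular rational orthogonal matrix with $Q_0^{\rm T}S(\Sigma)Q_0=S(\Sigma^{\rm T})$, with level $\ell_0$. If $Q\in\mathcal{Q}(\Sigma)$ has level $\ell$, then $\ell\mid\ell_0$.
   Context: An oriented graph $\Sigma$ on vertices $v_1,\dots,v_n$ is a simple graph each of whose edges is given a direction. Its skew-adjacency matrix $S(\Sigma)=(s_{ij})$ has $s_{ij}=1$ if $(v_i,v_j)$ is an arc, $-1$ if $(v_j,v_i)$ is an arc, $0$ otherwise. The converse $\Sigma^{\rm T}$ reverses every arc, so $S(\Sigma^{\rm T})=-S(\Sigma)$. Two oriented graphs are generalized cospectral if their skew-adjacency matrices $S$ have the same spectrum and the matrices $J-I-S$ have the same spectrum ($J$ all-one matrix, $I$ identity). Let $e$ be the all-one vector and $W(\Sigma)=[e,Se,\dots,S^{n-1}e]$, $S=S(\Sigma)$. $\mathcal{G}_n$ is the set of $n$-vertex oriented graphs with $2^{-\lfloor n/2\rfloor}\det W(\Sigma)$ an odd square-free integer. A rational orthogonal matrix $Q$ is regular if $Qe=e$; its level is the least positive integer $k$ with $kQ$ integral. $\mathcal{Q}(\Sigma)$ is the set of all regular rational orthogonal matrices $Q$ such that $Q^{\rm T}S(\Sigma)Q=S(\Delta)$ for some oriented graph $\Delta$ generalized cospectral with $\Sigma$. For $\det W(\Sigma)\ne0$ such $Q$ is unique for each $\Delta$, so $Q_0$ is well defined. *)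

(* Defs.v *)
From HB Require Import structures.
From mathcomp Require Import all_boot all_order all_algebra.
Set Implicit Arguments. Unset Strict Implicit. Unset Printing Implicit Defensive.
Import Order.TTheory GRing.Theory Num.Theory.
Local Open Scope ring_scope.

(* Skew-adjacency matrix of an oriented graph on vertices 'I_n:
   entries in {0,1,-1} and S^T = -S (so diagonal is zero; s_ij = 1 iff
   (v_i,v_j) is an arc, -1 iff (v_j,v_i) is an arc). *)
Definition is_skew_adj (n : nat) (S : 'M[int]_n) : Prop :=
  (forall i j, S i j \in [:: 0; 1; -1]) /\ S^T = - S.

Definition converse (n : nat) (S : 'M[int]_n) : 'M[int]_n := - S.

Definition gen_cospectral (n : nat) (S1 S2 : 'M[int]_n) : Prop :=
  char_poly S1 = char_poly S2 /\
  char_poly (const_mx 1 - 1%:M - S1) = char_poly (const_mx 1 - 1%:M - S2).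

Definition walk_mx (n : nat) (S : 'M[int]_n) : 'M[int]_n :=
  \matrix_(i < n, j < n) ((S ^+ j) *m (const_mx 1 : 'cV[int]_n)) i ord0.

Definition squarefree (m : nat) : Prop :=
  forall p : nat, prime p -> ~~ (p * p %| m)%N.

Definition in_Gn (n : nat) (S : 'M[int]_n) : Prop :=
  is_skew_adj S /\
  exists z : int, \det (walk_mx S) = 2 ^+ (n./2) * z /\ odd `|z|%N /\ squarefree `|z|%N.

Definition intr_mx (n : nat) (S : 'M[int]_n) : 'M[rat]_n := map_mx intr S.

Definition reg_orth (n : nat) (Q : 'M[rat]_n) : Prop :=
  Q^T *m Q = 1%:M /\ Q *m (const_mx 1 : 'cV[rat]_n) = const_mx 1.

Definition integral_mx (n : nat) (A : 'M[rat]_n) : Prop :=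
  exists M : 'M[int]_n, A = map_mx intr M.

Definition is_level (n : nat) (Q : 'M[rat]_n) (l : nat) : Prop :=
  (0 < l)%N /\ integral_mx (l%:R *: Q) /\
  forall k : nat, (0 < k)%N -> integral_mx (k%:R *: Q) -> (l <= k)%N.

Definition in_QSigma (n : nat) (S : 'M[int]_n) (Q : 'M[rat]_n) : Prop :=
  reg_orth Q /\
  exists D : 'M[int]_n, is_skew_adj D /\ gen_cospectral S D /\
    Q^T *m intr_mx S *m Q = intr_mx D.

(* Main.v *)
(* Write N = l Q^T, an integral matrix with N S = D N, N e = l e and N N^T = l^2,
   and W for the walk matrix of S; then N W = l W(D), so the rows of N lie in the
   left kernel of W modulo every prime p dividing l, and l divides det W.

   p = 2 is impossible.  The squared lengths |S^j u|^2 of a row u of N and its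
   images vanish modulo 4.  The corank of W modulo 2 is at most n/2, so its left
   kernel is spanned by S e, ..., S^(n/2) e, and on that span the squared length
   modulo 4 is additive, with a Hankel matrix of values that is invertible
   because det W is not divisible by a higher power of 2.

   For p odd, the left kernel of W modulo p is a line, spanned by a row r of N, and
   r S = c r.  If p does not divide l0, then N0 = l0 Q0^T is invertible modulo p,
   preserves that line and anticommutes with S, so c = 0.  Then r can be corrected
   modulo p into a vector that annihilates W modulo p^2, whence p^2 divides det W. *)

Require Import Defs.
From HB Require Import structures.
From mathcomp Require Import all_boot all_order all_algebra.
From mathcomp Require Import zify ring.
Import Order.TTheory GRing.Theory Num.Theory.
Local Open Scope ring_scope.

Set Implicit Arguments.
Unset Strict Implicit.
Unset Printing Implicit Defensive.

Local Notation ones n := (const_mx 1 : 'cV_n).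
Local Notation red p := (map_mx (intr : int -> 'F_p)).

(** * Walk matrices over a commutative ring, and intertwining *)

Definition walk (R : comNzRingType) (n : nat) (S : 'M[R]_n) : 'M[R]_n :=
  \matrix_(i < n, j < n) ((S ^+ j) *m ones n) i ord0.

Lemma mul_walkE (R : comNzRingType) m n (A : 'M[R]_(m, n)) (S : 'M[R]_n) i j :
  (A *m walk S) i j = (A *m (S ^+ (j : nat) *m ones n)) i ord0.
Proof. by rewrite !mxE; apply: eq_bigr => k _; rewrite !mxE. Qed.

Lemma mul_walk_eq0P (R : comNzRingType) m n (A : 'M[R]_(m, n)) (S : 'M[R]_n) :
  A *m walk S = 0 <->
  forall j, (j < n)%N -> A *m (S ^+ j *m ones n) = 0.
Proof.
split=> [AW j lt_jn | AW]; last first.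
  by apply/matrixP=> i j; rewrite mul_walkE AW ?mxE.
apply/matrixP=> i k; rewrite !ord1.
by rewrite -(mul_walkE A S i (Ordinal lt_jn)) AW !mxE.
Qed.

Lemma map_mx_exp (R T : comNzRingType) (f : {rmorphism R -> T}) n (S : 'M[R]_n) j :
  map_mx f (S ^+ j) = map_mx f S ^+ j.
Proof.
elim: j => [|j IH]; first by rewrite !expr0 map_mx1.
by rewrite !exprS -!mulmxE map_mxM IH.
Qed.

Lemma map_walk (R T : comNzRingType) (f : {rmorphism R -> T}) n (S : 'M[R]_n) :
  map_mx f (walk S) = walk (map_mx f S).
Proof.
apply/matrixP=> i j; rewrite !mxE.
rewrite rmorph_sum; apply: eq_bigr => k _.
by rewrite -map_mx_exp !mxE rmorphM rmorph1.
Qed.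

Lemma intertwine_exp (R : comNzRingType) m n (N : 'M[R]_(m, n)) (S : 'M[R]_n)
    (D : 'M[R]_m) j :
  N *m S = D *m N -> N *m S ^+ j = D ^+ j *m N.
Proof.
move=> NS; elim: j => [|j IH]; first by rewrite !expr0 mulmx1 mul1mx.
by rewrite !exprS -!mulmxE mulmxA NS -mulmxA IH mulmxA.
Qed.

Lemma intertwine_walk (R : comNzRingType) n (N S D : 'M[R]_n) a :
  N *m S = D *m N -> N *m ones n = a *: ones n ->
  N *m walk S = a *: walk D.
Proof.
move=> NS Ne; apply/matrixP=> i j; rewrite mul_walkE mulmxA (intertwine_exp j NS).
by rewrite -mulmxA Ne -scalemxAr !mxE.
Qed.

Lemma exprN_mx (R : comNzRingType) n (S : 'M[R]_n) j :
  (- S) ^+ j = (-1) ^+ j *: S ^+ j.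
Proof.
elim: j => [|j IH]; first by rewrite !expr0 scale1r.
by rewrite !exprS IH mulN1r -!mulmxE mulNmx -scalemxAr scaleNr.
Qed.

Lemma mul_walkN_eq0 (R : comNzRingType) m n (A : 'M[R]_(m, n)) (S : 'M[R]_n) :
  A *m walk S = 0 -> A *m walk (- S) = 0.
Proof.
move=> /mul_walk_eq0P AW; apply/mul_walk_eq0P => j lt_jn.
by rewrite exprN_mx -scalemxAl -scalemxAr AW // scaler0.
Qed.

(** * Reduction of integer matrices modulo a prime *)

Lemma intr_Fp_eq0 p (x : int) : prime p -> (x%:~R == 0 :> 'F_p) = (p %| x)%Z.
Proof.
move=> p_pr; rewrite dvdzE /=; case: x => x.
  by rewrite /= -pmulrn -(dvdn_pcharf (pchar_Fp p_pr)).
by rewrite NegzE mulrNz oppr_eq0 /= -pmulrn -(dvdn_pcharf (pchar_Fp p_pr)).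
Qed.

Lemma dvd_mxP m n (d : int) (A : 'M[int]_(m, n)) :
  (forall i j, (d %| A i j)%Z) -> exists B, A = d *: B.
Proof.
move=> dA; exists (\matrix_(i, j) (A i j %/ d)%Z).
by apply/matrixP=> i j; rewrite !mxE mulrC divzK.
Qed.

Lemma red_eq0P p m n (A : 'M[int]_(m, n)) : prime p ->
  red p A = 0 <-> exists B, A = p%:Z *: B.
Proof.
move=> p_pr; split=> [A0 | [B ->]]; last first.
  apply/matrixP=> i j; rewrite !mxE; apply/eqP.
  by rewrite intr_Fp_eq0 // dvdz_mulr.
apply: dvd_mxP => i j; rewrite -intr_Fp_eq0 //; apply/eqP.
by have /matrixP/(_ i j) := A0; rewrite !mxE.
Qed.

Definition lift_Fp p m n (B : 'M['F_p]_(m, n)) : 'M[int]_(m, n) :=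
  \matrix_(i, j) (B i j : nat)%:Z.

Lemma lift_FpK p m n (B : 'M['F_p]_(m, n)) : red p (lift_Fp B) = B.
Proof. by apply/matrixP=> i j; rewrite !mxE -pmulrn natr_Zp. Qed.

Lemma red_surj p m n (B : 'M['F_p]_(m, n)) : exists A : 'M[int]_(m, n), red p A = B.
Proof. by exists (lift_Fp B); apply: lift_FpK. Qed.

(** An integral lift [P] of the inverse column basis clears, modulo p, all rows beyond the rank.
    Those rows of [P *m A] are divisible by p, so p to the corank divides det P * det A, where det P
    is prime to p. *)
Lemma corank_red p k n (A : 'M[int]_n) : prime p ->
  ~~ ((p ^ k.+1)%N%:Z %| \det A)%Z -> (n - \rank (red p A) <= k)%N.
Proof.
move=> p_pr; apply: contraR; rewrite -ltnNge => lt_k.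
set r := \rank (red p A) in lt_k.
have [P PE] := red_surj (invmx (col_ebase (red p A))).
have Pdet : ~~ (p %| \det P)%Z.
  have : red p P \in unitmx by rewrite PE unitmx_inv col_ebase_unit.
  by rewrite unitmxE unitfE det_map_mx intr_Fp_eq0.
pose t (i : 'I_n) : int := if (i < r)%N then 1 else p%:Z.
have [B PAB] : exists B, P *m A = diag_mx (\row_i t i) *m B.
  exists (\matrix_(i, j) ((P *m A) i j %/ t i)%Z).
  apply/matrixP=> i j; rewrite mul_diag_mx !mxE mulrC /t.
  case: ltnP => [|le_ri]; first by rewrite divz1 mulr1.
  rewrite divzK // -intr_Fp_eq0 //.
  have : red p (P *m A) = pid_mx r *m row_ebase (red p A).
    rewrite map_mxM PE -{2}(mulmx_ebase (red p A)) !mulmxA mulVmx ?mul1mx //.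
    exact: col_ebase_unit.
  move=> /matrixP/(_ i j); rewrite !mxE => ->.
  apply/eqP; rewrite big1 // => l _; rewrite !mxE.
  by rewrite [(i < r)%N]ltnNge le_ri andbF mul0r.
have tdet : \det (diag_mx (\row_i t i)) = (p ^ (n - r))%N%:Z.
  rewrite det_diag (eq_bigr t) => [|i _]; last by rewrite mxE.
  rewrite (bigID (fun i : 'I_n => (i < r)%N)) /= big1 => [|i]; last by rewrite /t => ->.
  rewrite mul1r (eq_bigr (fun=> p%:Z)) => [|i]; last by rewrite /t; case: ltnP.
  rewrite prodr_const -[RHS]natz natrX natz; congr (_ ^+ _).
  rewrite -(subnKC (rank_leq_row (red p A) : (r <= n)%N)).
  rewrite -sum1_card big_mkcond /=.
  rewrite big_split_ord /= big1 ?add0n => [|i _]; last by rewrite unfold_in /= ltn_ord.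
  rewrite (eq_bigr (fun=> 1%N)) => [|i _]; last by rewrite unfold_in /= -leqNgt leq_addr.
  by rewrite sum1_card card_ord addKn.
have : ((p ^ k.+1)%N%:Z %| \det P * \det A)%Z.
  rewrite -det_mulmx PAB det_mulmx tdet dvdz_mulr // dvdzE /=.
  exact: dvdn_exp2l.
by rewrite Gauss_dvdzr // coprimezE /= coprimeXl // prime_coprime.
Qed.

(** * The linear system behind lifting a kernel vector from modulo p to modulo p^2 *)

(** A row space is the annihilator of its annihilator. This turns the solvability of a linear system
    into a test on a kernel. *)
Lemma submx_coker_colP (F : fieldType) m1 m2 n (v : 'M[F]_(m1, n)) (A : 'M_(m2, n)) :
  (forall x : 'cV_n, A *m x = 0 -> v *m x = 0) -> (v <= A)%MS.
Proof.
move=> Av; rewrite submxE; apply/eqP/matrixP=> i j.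
have : v *m col j (cokermx A) = 0.
  by apply: Av; rewrite colE mulmxA mulmx_coker mul0mx.
by rewrite colE mulmxA -colE => /matrixP/(_ i ord0); rewrite !mxE.
Qed.

(** Every walk vector other than e is S applied to the preceding one; hence S lowers the dimension
    of the walk span by at most one. *)
Lemma walk_submx_shift (F : fieldType) n (S : 'M[F]_n) :
  ((walk S)^T <= (walk S)^T *m S^T + (ones n)^T)%MS.
Proof.
have rowW (j : 'I_n) : row j (walk S)^T = (S ^+ (j : nat) *m ones n)^T.
  by apply/rowP=> b; rewrite !mxE.
apply/row_subP=> -[j lt_jn]; rewrite rowW /=.
case: j lt_jn => [|j] lt_jn; first by rewrite expr0 mul1mx addsmxSr.
apply: submx_trans (addsmxSl _ _).
rewrite exprS -mulmxE -mulmxA trmx_mul.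
by rewrite -(rowW (Ordinal (ltnW lt_jn))) submxMr // row_sub.
Qed.

(* The unknowns [c, a] solve a square singular system; its solvability is checked
   against the kernel of the transposed system.  The span of the walk vectors is
   the orthogonal of [r], it contains [r], and [S] maps it onto a hyperplane
   of itself not containing the all-one vector. *)
Lemma walk_lift_solvable (F : fieldType) n (S : 'M[F]_n) (r w : 'rV_n) (b : F) :
  S^T = - S -> r != 0 -> r *m S = 0 -> r *m r^T = 0 ->
  (forall s : 'rV_n, s *m walk S = 0 -> (s <= r)%MS) ->
  w *m r^T = 0 ->
  exists c : 'rV_n, exists a : F, w + c *m S = a *: r /\ c *m ones n = b%:M.
Proof.
move=> Ssk r0 rS rr Wr wr; set C := (walk S)^T.
have orthC (y : 'cV_n) : r *m y = 0 -> (y^T <= C)%MS.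
  move=> ry; rewrite submxE -trmx_eq0 trmx_mul trmxK.
  have /submxP[d ->] : ((cokermx C)^T <= r)%MS.
    apply/row_subP=> i; apply: Wr.
    by rewrite -row_mul -[walk _]trmxK -trmx_mul mulmx_coker trmx0 row0.
  by rewrite -mulmxA ry mulmx0.
have rC : (r <= C)%MS by rewrite -[r]trmxK orthC.
have rST : r *m S^T = 0 by rewrite Ssk mulmxN rS oppr0.
have rcap : (r <= C :&: kermx S^T)%MS.
  by rewrite sub_capmx rC; apply/sub_kermxP.
have rkr : \rank r = 1%N by rewrite rank_rV r0.
have Cshift := walk_submx_shift S.
have rk_ker := mxrank_mul_ker C S^T.
(* The row [[c, -a]] times [A] is [[c S - a r, c e]], so the target is [[-w, b]]. *)
pose A := block_mx S (ones n) r (0 : 'M_1).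
have : (row_mx (- w) b%:M <= A)%MS.
  apply: submx_coker_colP => x; rewrite -[x]vsubmxK.
  move: (usubmx x) (dsubmx x) => y g; rewrite mul_block_col mul_row_col mul0mx addr0.
  move=> /eqP; rewrite col_mx_eq0 => /andP[/eqP Sy /eqP ry].
  have yC := orthC y ry.
  have yS : y^T *m S^T = - (g 0 0 *: (ones n)^T).
    apply/eqP; rewrite -addr_eq0 -trmx_mul -linearZ -linearD /= trmx_eq0 -[eqbRHS]Sy.
    by rewrite [g in eqbRHS]mx11_scalar mul_mx_scalar.
  (* If g is nonzero, e lies in the image of the walk span under S, so S is injective on that span,
     although it kills r there. If g is zero, y lies in the part of the span killed by S, which is
     the line of r, and w is orthogonal to r. *)
  have [g0|g0] := eqVneq (g 0 0) 0; last first.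
    have EC : ((ones n)^T <= C *m S^T)%MS.
      have -> : (ones n)^T = - (g 0 0)^-1 *: (y^T *m S^T) :> 'rV_n.
        by rewrite yS scalerN scaleNr opprK scalerA mulVf ?scale1r.
      by rewrite scalemx_sub // submxMr.
    have := submx_trans Cshift (_ : (_ <= C *m S^T)%MS).
    rewrite addsmx_sub submx_refl EC => /(_ isT) /mxrankS.
    rewrite -/C -[X in (X <= _)%N]rk_ker -[X in (_ <= X)%N]addn0 leq_add2l.
    by have := mxrankS rcap; rewrite rkr; case: (\rank _).
  have ycap : (y^T <= C :&: kermx S^T)%MS.
    by rewrite sub_capmx yC; apply/sub_kermxP; rewrite yS g0 scale0r oppr0.
  have rkcap : (\rank (C :&: kermx S^T)%MS <= \rank r)%N.
    rewrite rkr -(leq_add2l (\rank (C *m S^T))) rk_ker.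
    apply: leq_trans (mxrankS Cshift) _.
    apply: leq_trans (mxrank_adds_leqif _ _) _.
    by rewrite leq_add2l rank_leq_row.
  have /submxP[d dE] : (y^T <= r)%MS.
    apply: submx_trans ycap _.
    by rewrite -(mxrank_leqif_sup rcap) eqn_leq rkcap mxrankS.
  have -> : y = r^T *m d^T by rewrite -trmx_mul -dE trmxK.
  rewrite [g]mx11_scalar g0 mulNmx mulmxA wr mul0mx oppr0 add0r.
  by rewrite raddf0 mulmx0.
case/submxP=> d; rewrite -[d]hsubmxK mul_row_block mulmx0 addr0.
move/eq_row_mx=> [wE bE]; exists (lsubmx d), (- (rsubmx d) 0 0).
split=> //; rewrite scaleNr.
have -> : rsubmx d 0 0 *: r = rsubmx d *m r.
  by rewrite {2}[rsubmx d]mx11_scalar mul_scalar_mx.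
by rewrite -[w]opprK wE opprD addrAC addNr add0r.
Qed.

(** * Odd primes dividing the level *)

Definition scaled_similarity (n : nat) (S D N : 'M[int]_n) (l : nat) : Prop :=
  [/\ N *m S = D *m N, N *m ones n = l%:Z *: ones n & N *m N^T = (l%:Z ^+ 2)%:M].

Lemma scaled_similarity_walk n (S D N : 'M[int]_n) l :
  scaled_similarity S D N l -> N *m walk S = l%:Z *: walk D.
Proof. by case=> NS Ne _; apply: intertwine_walk. Qed.

Lemma red_dvdz p m n (x : int) (A : 'M[int]_(m, n)) : prime p -> (p %| x)%Z ->
  red p (x *: A) = 0.
Proof.
move=> p_pr; rewrite -intr_Fp_eq0 // => /eqP x0.
by apply/matrixP=> i j; rewrite !mxE rmorphM /= x0 mul0r.
Qed.

Lemma skew_form_eq0 n (S : 'M[int]_n) (r : 'rV_n) : S^T = - S -> r *m S *m r^T = 0.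
Proof.
move=> Ssk; set x := r *m S *m r^T.
have : x^T = - x by rewrite /x !trmx_mul trmxK Ssk mulNmx mulmxN mulmxA.
move/matrixP/(_ 0 0); rewrite mxE [(- x) _ _]mxE => /eqP; rewrite eq_sym.
rewrite eqNr => /eqP x0.
by rewrite [x]mx11_scalar x0 raddf0.
Qed.

(** Multiplying by the adjugate shows that p^k divides [r 0 i * \det A], and [r 0 i] is prime to
    p. *)
Lemma dvdz_det_left_kernel n (A : 'M[int]_n) (r z : 'rV[int]_n) (p k : nat) (i : 'I_n) :
  prime p -> ~~ (p %| r ord0 i)%Z -> r *m A = (p ^ k)%N%:Z *: z ->
  ((p ^ k)%N%:Z %| \det A)%Z.
Proof.
move=> p_pr ri rA.
have : ((p ^ k)%N%:Z %| r ord0 i * \det A)%Z.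
  have -> : r 0 i * \det A = (r *m A *m \adj A) 0 i.
    by rewrite -mulmxA mul_mx_adj mul_mx_scalar mxE mulrC.
  by rewrite rA -scalemxAl mxE dvdz_mulr.
by rewrite Gauss_dvdzr // coprimezE coprimeXl // prime_coprime.
Qed.

Lemma odd_prime_dvd_converse_level n (S D N N0 : 'M[int]_n) (l l0 p : nat) :
  prime p -> odd p -> S^T = - S ->
  ~~ ((p ^ 2)%N%:Z %| \det (walk S))%Z ->
  scaled_similarity S D N l -> scaled_similarity S (- S) N0 l0 ->
  (p %| l)%N -> red p N != 0 -> (p %| l0)%N.
Proof.
move=> p_pr p_odd Ssk detW simN simN0 p_l N0p; apply: contraT => p_l0.
have NW := scaled_similarity_walk simN.
have N0W := scaled_similarity_walk simN0.
case: simN => NS Ne NN; case: simN0 => N0S N0e NN0.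
have [i ri0] : exists i, row i (red p N) != 0.
  apply/existsP; apply: contraR N0p; rewrite negb_exists => /forallP rows0.
  by apply/eqP/row_matrixP=> i; rewrite row0; apply/eqP; rewrite -[_ == _]negbK.
pose r := row i N; pose rb := red p r.
have rb0 : rb != 0 by rewrite /rb map_row.
pose Sb := red p S; pose W := walk S; pose Wb := walk Sb.
have WbE : red p W = Wb by rewrite /W map_walk.
have NbW : red p N *m Wb = 0.
  by rewrite -WbE -map_mxM NW red_dvdz.
have rbN : rb = row i (red p N) by rewrite /rb map_row.
have rbW : rb *m Wb = 0 by rewrite rbN -row_mul NbW row0.
(* Since p^2 does not divide det W, the corank modulo p is at most one. *)
have kerW (s : 'rV_n) : s *m Wb = 0 -> (s <= rb)%MS.
  move=> sW; have rb_ker : (rb <= kermx Wb)%MS by apply/sub_kermxP.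
  have s_ker : (s <= kermx Wb)%MS by apply/sub_kermxP.
  apply: submx_trans s_ker _; rewrite -(mxrank_leqif_sup rb_ker) eqn_leq mxrankS //=.
  by rewrite rank_rV rb0 mxrank_ker -WbE corank_red.
(* [r S] is a row of [D N], hence a combination of rows of [N], all of which lie in the kernel
   modulo p. *)
have [d rbS] : exists d : 'M_1, rb *m Sb = d *m rb.
  apply/submxP/kerW.
  rewrite rbN -row_mul /Sb -map_mxM NS map_mxM row_mul -!mulmxA.
  by rewrite NbW mulmx0.
(* The columns of [walk (- S)] are those of [walk S] up to sign, so [N0] preserves the kernel. *)
have [m rbN0] : exists m : 'M_1, rb *m red p N0 = m *m rb.
  apply/submxP/kerW.
  rewrite -mulmxA -WbE -map_mxM N0W map_mxZ -scalemxAr map_walk.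
  by rewrite map_mxN mul_walkN_eq0 ?scaler0.
have l0_neq0 : (l0%:Z)%:~R != 0 :> 'F_p by rewrite intr_Fp_eq0.
have scal1 (x : 'M['F_p]_1) (v : 'rV_n) : x *m v = x 0 0 *: v.
  by rewrite {1}[x]mx11_scalar mul_scalar_mx.
rewrite scal1 in rbS; rewrite scal1 in rbN0.
have m0 : m 0 0 != 0.
  apply: contraNneq rb0 => m0; rewrite m0 scale0r in rbN0.
  have : rb *m red p (N0 *m N0^T) = 0 by rewrite map_mxM mulmxA rbN0 mul0mx.
  rewrite NN0 map_scalar_mx mul_mx_scalar => /eqP.
  by rewrite scaler_eq0 rmorphXn expf_eq0 /= (negPf l0_neq0).
(* Evaluating [r N0 S = - r S N0] on the line gives 2 d m = 0, with m nonzero and p odd. *)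
have d0 : d 0 0 = 0.
  have : rb *m red p (N0 *m S) = - (rb *m red p (S *m N0)).
    by rewrite N0S mulNmx map_mxN mulmxN.
  rewrite !map_mxM !mulmxA rbN0 -/Sb rbS -!scalemxAl rbS rbN0 !scalerA.
  rewrite [d 0 0 * _]mulrC => /eqP; rewrite -addr_eq0 -mulr2n -scaler_nat.
  rewrite !scaler_eq0 (negPf rb0) orbF mulf_eq0 (negPf m0) /=.
  rewrite -(dvdn_pcharf (pchar_Fp p_pr)) => /orP[|/eqP //].
  rewrite dvdn_prime2 // => /eqP p2; by rewrite p2 in p_odd.
rewrite d0 scale0r in rbS.
have [w rSw] : exists w, r *m S = p%:Z *: w.
  by apply/red_eq0P=> //; rewrite map_mxM.
have p_neq0 : p%:Z != 0 by case: (p) p_pr.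
(* [r S r^T] vanishes over the integers, not only modulo p, so p can be cancelled. *)
have wr : w *m r^T = 0.
  have := skew_form_eq0 r Ssk; rewrite rSw -scalemxAl => /eqP.
  by rewrite scalemx_eq0 (negPf p_neq0) => /eqP.
have rr : rb *m rb^T = 0.
  rewrite /rb map_trmx -map_mxM.
  have -> : r *m r^T = (l%:Z ^+ 2)%:M.
    rewrite [LHS]mx11_scalar; congr (_%:M).
    have /matrixP/(_ i i) := NN; rewrite !mxE eqxx mulr1n => <-.
    by apply: eq_bigr => k _; rewrite !mxE.
  by rewrite -scalemx1 red_dvdz // dvdz_exp.
have rSje j : exists z, r *m (S ^+ j *m ones n) = p%:Z *: z.
  apply/red_eq0P=> //; rewrite mulmxA -row_mul (intertwine_exp _ NS).
  rewrite row_mul -mulmxA.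
  have -> : row i (D ^+ j) *m (N *m ones n) = l%:Z *: (row i (D ^+ j) *m ones n).
    by rewrite Ne scalemxAr.
  exact: red_dvdz.
have [z rez] := rSje 0%N; rewrite expr0 mul1mx in rez.
(* Here w = r S / p and z = r e / p. The correction c is chosen so that, modulo p, w + c S lies on
   the line of r and z + c e vanishes. *)
have [| |cb [ab [cabS cbe]]] :=
    @walk_lift_solvable _ n Sb rb (red p w) (- red p z 0 0) _ rb0 rbS rr kerW.
- by rewrite /Sb map_trmx Ssk map_mxN.
- by rewrite /rb map_trmx -map_mxM wr map_mx0.
have [c cE] := red_surj cb; have [a aE] := red_surj (ab%:M : 'M_1).
have [t tE] : exists t, w + c *m S - a 0 0 *: r = p%:Z *: t.
  apply/red_eq0P=> //; rewrite map_mxB map_mxD map_mxM map_mxZ cE cabS.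
  have /matrixP/(_ 0 0) := aE; rewrite !mxE eqxx mulr1n /= => ->.
  by rewrite subrr.
have [y yE] : exists y, z + c *m ones n = p%:Z *: y.
  apply/red_eq0P=> //; rewrite map_mxD map_mxM cE map_const_mx rmorph1 cbe.
  by rewrite [X in X + _]mx11_scalar -raddfD /= addrN raddf0.
(* For positive exponents, (r + p c) S = p (a r + p t) and r annihilates the walk vectors modulo p;
   exponent zero uses the condition on z + c e. *)
have [x r'W] : exists x, (r + p%:Z *: c) *m W = (p ^ 2)%N%:Z *: x.
  apply: dvd_mxP => i' j; rewrite ord1 mul_walkE.
  case: (nat_of_ord j) => [|k].
    rewrite expr0 mul1mx mulmxDl rez -scalemxAl -scalerDr yE scalerA.
    by rewrite mxE dvdz_mulr.
  rewrite exprS -mulmxE -mulmxA mulmxA mulmxDl rSw -scalemxAl -scalerDr.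
  have -> : w + c *m S = a 0 0 *: r + p%:Z *: t by rewrite -tE [RHS]addrC subrK.
  have [q qE] := rSje k.
  rewrite -scalemxAl mulmxDl -!scalemxAl qE.
  rewrite [a 0 0 *: _]scalerA [a 0 0 * _]mulrC -scalerA -scalerDr scalerA.
  by rewrite mxE dvdz_mulr.
have [k rk] : exists k, rb 0 k != 0 by apply/rV0Pn.
case/negP: detW; apply: (dvdz_det_left_kernel (i := k) p_pr _ r'W).
rewrite -intr_Fp_eq0 //.
have -> : ((r + p%:Z *: c) 0 k)%:~R = rb 0 k + red p (p%:Z *: c) 0 k :> 'F_p.
  by rewrite !mxE rmorphD.
by rewrite red_dvdz // [X in _ + X]mxE addr0.
Qed.

(** * Walk counts modulo 4 and the prime 2 *)

(** The signed number of walks of length t. Up to sign these are the entries of the Gram matrix of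
    the walk vectors, which thus depend only on the sum of the two indices. *)
Definition walk_count n (S : 'M[int]_n) (t : nat) : int :=
  ((ones n)^T *m (S ^+ t *m ones n)) 0 0.

Definition dot n (v w : 'cV[int]_n) : int := (v^T *m w) 0 0.

Lemma dotDl n (u v w : 'cV[int]_n) : dot (u + v) w = dot u w + dot v w.
Proof. by rewrite /dot linearD mulmxDl mxE. Qed.

Lemma dotZl n a (v w : 'cV[int]_n) : dot (a *: v) w = a * dot v w.
Proof. by rewrite /dot linearZ -scalemxAl mxE. Qed.

Lemma dotC n (v w : 'cV[int]_n) : dot v w = dot w v.
Proof. by rewrite /dot -[w^T *m v]trmxK [RHS]mxE trmx_mul trmxK. Qed.

Lemma trmx_exp_skew n (S : 'M[int]_n) j :
  S^T = - S -> (S ^+ j)^T = (-1) ^+ j *: S ^+ j.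
Proof.
move=> Ssk; rewrite -exprN_mx -Ssk.
elim: j => [|j IH]; first by rewrite !expr0 trmx1.
by rewrite exprS exprSr -!mulmxE trmx_mul IH.
Qed.

Lemma dot_exp n (S : 'M[int]_n) i k : S^T = - S ->
  dot (S ^+ i *m ones n) (S ^+ k *m ones n) = (-1) ^+ i * walk_count S (i + k).
Proof.
move=> Ssk; rewrite /dot trmx_mul trmx_exp_skew // -mulmxA -scalemxAl -scalemxAr.
by rewrite mxE mulmxA mulmxE -exprD.
Qed.

Lemma dvdz2_sqrB (a : int) : (2 %| a * a - a)%Z.
Proof. by rewrite -[X in _ - X]mulr1 -mulrBr dvdzE abszM /= dvdn2 oddM; lia. Qed.

Lemma dot_self_even n (v : 'cV[int]_n) : (2 %| dot v v - dot (ones n) v)%Z.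
Proof.
rewrite /dot !mxE -sumrB; apply: rpred_sum => k _; rewrite !mxE mul1r.
exact: dvdz2_sqrB.
Qed.

Lemma walk_count_odd n (S : 'M[int]_n) t :
  S^T = - S -> odd t -> walk_count S t = 0.
Proof.
move=> Ssk odd_t; have := dot_exp 0 t Ssk.
rewrite dotC dot_exp // addn0 add0n -signr_odd odd_t expr0 expr1 mulN1r mul1r.
by move=> /eqP; rewrite eqNr => /eqP.
Qed.

(** For even t the count is, up to sign, the squared length of S^(t/2) e. Modulo 2 this is the sum
    of the entries of that vector, which is the count for t/2. *)
Lemma walk_count_even n (S : 'M[int]_n) t :
  S^T = - S -> (0 < t)%N -> (2 %| walk_count S t)%Z.
Proof.
move=> Ssk; elim/ltn_ind: t => t IH t_gt0.
have [odd_t|even_t] := boolP (odd t); first by rewrite walk_count_odd.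
have tE : t = (t./2 + t./2)%N by rewrite addnn even_halfK.
have s_gt0 : (0 < t./2)%N by case: (t) t_gt0 even_t => [|[|]].
have := rpredD (dot_self_even (S ^+ t./2 *m ones n)) (IH t./2 _ s_gt0).
rewrite subrK dot_exp // -tE !dvdzE abszM abszX exp1n mul1n; apply; lia.
Qed.

Lemma sum_odd_ord (n : nat) (F : nat -> int) :
  \sum_(l < n) (if odd l then F l else 0) = \sum_(i < n./2) F i.*2.+1.
Proof.
elim: n => [|n IH]; first by rewrite !big_ord0.
rewrite big_ord_recr IH /= uphalf_half; case: ifP => odd_n; last by rewrite addr0 add0n.
by rewrite add1n big_ord_recr /=; congr (_ + F _); rewrite -[LHS]odd_double_half odd_n.
Qed.

(* All rows of the Gram matrix of the walk vectors are even, except row 0 when n is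
   odd; halving the even ones leaves a matrix [H] of odd determinant. *)
Lemma walk_count_hankel_even n (S : 'M[int]_n) (z : int) (y : nat -> int) :
  S^T = - S -> \det (walk S) = 2 ^+ n./2 * z -> odd `|z|%N ->
  (forall j, (4 %| \sum_(i < n./2) y i * walk_count S (i + j).+1.*2)%Z) ->
  forall i, (i < n./2)%N -> (2 %| y i)%Z.
Proof.
move=> Ssk detW odd_z y4 i lt_i.
pose G := (walk S)^T *m walk S.
have GE (j k : 'I_n) : G j k = (-1) ^+ (j : nat) * walk_count S (j + k).
  rewrite -dot_exp // /G /dot mxE [RHS]mxE; apply: eq_bigr => l _.
  have walkE (a b : 'I_n) : walk S a b = (S ^+ (b : nat) *m ones n) a 0.
    by rewrite mxE.
  by rewrite [in LHS]mxE [in RHS]mxE !walkE.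
pose t (k : 'I_n) : int := if (k == 0 :> nat) && odd n then 1 else 2.
have [H GH] : exists H, G = diag_mx (\row_i t i) *m H.
  exists (\matrix_(i, j) (G i j %/ t i)%Z).
  apply/matrixP=> j k; rewrite mul_diag_mx [RHS]mxE [X in X * _]mxE [X in _ * X]mxE.
  rewrite mulrC divzK // GE /t -signr_odd dvdz_mull //.
  case: ifP => [_|/negbT]; first by rewrite dvd1z.
  have [jk0|jk_gt0] := posnP (j + k)%N; last by rewrite walk_count_even.
  rewrite jk0 (_ : j = 0%N :> nat); last by lia.
  rewrite /walk_count expr0 mul1mx /= => n_even.
  rewrite mxE (eq_bigr (fun=> 1)) => [|l _]; last by rewrite !mxE mulr1.
  by rewrite sumr_const card_ord (natz n) dvdzE /= dvdn2.
have tdet : \prod_i t i = 2 ^+ (n./2).*2.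
  rewrite /t; case: (n) => [|n'] /=; first by rewrite big_ord0.
  rewrite big_ord_recl (eq_bigr (fun=> 2)) //= prodr_const card_ord.
  rewrite uphalf_half; have := odd_double_half n'.
  by case: (odd n') => /=; rewrite ?mul1r -?exprS => {1}<- //; rewrite doubleS.
(* The factors taken out of [G] make up the whole power of 2 in the square of det W. *)
have detH : \det H = z ^+ 2.
  have : \det G = 2 ^+ (n./2).*2 * z ^+ 2.
    by rewrite /G det_mulmx det_tr detW -expr2 exprMn -exprM muln2.
  rewrite GH det_mulmx det_diag (eq_bigr t) => [|k _]; last by rewrite mxE.
  by rewrite tdet => /mulfI; apply; rewrite expf_neq0.
(* [y i] is placed at index 2i+1. Even rows of [G] then meet only walk counts of odd length, which
   vanish, and odd rows give the sums of the hypothesis up to sign. *)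
pose x : 'cV[int]_n := \col_l (if odd l then y l./2 else 0).
have GxE (k : 'I_n) : (G *m x) k 0 =
    \sum_(l < n) (if odd l then (-1) ^+ (k : nat) * (y l./2 * walk_count S (k + l)) else 0).
  rewrite mxE; apply: eq_bigr => l _; rewrite GE mxE; case: ifP => _; last by rewrite mulr0.
  by rewrite -mulrA [_ * y _]mulrC.
have Hx (k : 'I_n) : (2 %| (H *m x) k ord0)%Z.
  have tH : t k * (H *m x) k 0 = (G *m x) k 0.
    by rewrite GH -mulmxA mul_diag_mx !mxE.
  have t0 : t k != 0 by rewrite /t; case: ifP.
  move: tH; rewrite GxE (sum_odd_ord _ (fun l => (-1) ^+ k * (y l./2 * walk_count S (k + l)))).
  rewrite -mulr_sumr.
  have [odd_k|even_k] := boolP (odd k); last first.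
    rewrite big1 => [|l _].
      by rewrite mulr0 => /eqP; rewrite mulf_eq0 (negPf t0) => /eqP->.
    by rewrite walk_count_odd ?mulr0 // oddD /= odd_double (negPf even_k).
  have -> : t k = 2 by rewrite /t; case: (nat_of_ord k) odd_k.
  have := y4 k./2; set s1 := \sum_(_ < _) _; set s2 := \sum_(_ < _) _.
  have -> : s2 = s1.
    apply: eq_bigr => l _; rewrite /= uphalf_double; congr (_ * walk_count _ _).
    by lia.
  rewrite -signr_odd odd_k expr1 => /dvdzP[q ->].
  by move: ((H *m x) k 0) => h; lia.
have lt_x : (i.*2.+1 < n)%N by lia.
apply: contraT => yi.
have [w Hw] : exists w, x^T *m H^T = (2 ^ 1)%N%:Z *: w.
  apply: dvd_mxP => a k; rewrite ord1 -trmx_mul mxE; exact: Hx.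
have := dvdz_det_left_kernel (i := Ordinal lt_x) (isT : prime 2) _ Hw.
rewrite det_tr detH !mxE /= odd_double /= uphalf_double => /(_ yi).
by rewrite dvdzE abszX /= dvdn2 oddX odd_z.
Qed.

(* The cross terms contribute twice an even number, and squares of integers may be
   replaced by the integers themselves in front of an even self-product. *)
Lemma dot_sum_mod4 n (w : nat -> 'cV[int]_n) (y : nat -> int) m :
  (forall i k, (2 %| dot (w i) (w k))%Z) ->
  (4 %| dot (\sum_(i < m) y i *: w i) (\sum_(i < m) y i *: w i) -
        \sum_(i < m) y i * dot (w i) (w i))%Z.
Proof.
move=> w2; elim: m => [|m IH]; first by rewrite !big_ord0 /dot mulmx0 mxE subrr.
rewrite !big_ord_recr /=; set s := \sum_(i < m) _ in IH *.
have sw2 : (2 %| dot s (w m))%Z.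
  rewrite /s; elim/big_ind: _ => [|u v u2 v2|i _].
  - by rewrite /dot trmx0 mul0mx mxE.
  - by rewrite dotDl rpredD.
  - by rewrite dotZl dvdz_mull.
rewrite dotDl ![dot _ (s + _)]dotC !dotDl !dotZl ![dot _ (_ *: _)]dotC !dotZl.
rewrite (dotC (w m) s); move: IH sw2 (w2 m m).
move: (dot s s) (dot s (w m)) (dot (w m) (w m)) (y m) (\sum_(_ < _) _).
move=> a b c d e /dvdzP[q aE] /dvdzP[b' ->] /dvdzP[c' ->].
have -> : a = q * 4 + e by rewrite -aE subrK.
have /dvdzP[t tE] := dvdz2_sqrB d.
apply/dvdzP; exists (q + d * b' + t * c').
have -> : d * (d * (c' * 2)) = (t * 2 + d) * (c' * 2) by rewrite -tE subrK mulrA.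
by ring.
Qed.

(** In the squared length of S^j u, the part 2 b contributes a multiple of 4, and signs in front of
    the even walk counts do not matter modulo 4. What remains is the Hankel system in [y]. *)
Lemma walk_span_even n (S : 'M[int]_n) (z : int) (y : nat -> int) (u b : 'cV[int]_n) :
  S^T = - S -> \det (walk S) = 2 ^+ n./2 * z -> odd `|z|%N ->
  u = \sum_(i < n./2) y i *: (S ^+ i.+1 *m ones n) + 2%:Z *: b ->
  (forall j, (4 %| dot (S ^+ j *m u) (S ^+ j *m u))%Z) ->
  forall i, (i < n./2)%N -> (2 %| y i)%Z.
Proof.
move=> Ssk detW odd_z uE u4; apply: (walk_count_hankel_even Ssk detW odd_z) => j.
pose w i := S ^+ (i + j).+1 *m ones n.
have w2 i k : (2 %| dot (w i) (w k))%Z.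
  by rewrite dot_exp // dvdz_mull // walk_count_even.
have SuE : S ^+ j *m u = \sum_(i < n./2) y i *: w i + 2%:Z *: (S ^+ j *m b).
  rewrite uE mulmxDr -scalemxAr mulmx_sumr; congr (_ + _).
  by apply: eq_bigr => i _; rewrite -scalemxAr mulmxA mulmxE -exprD addnS addnC.
have := dot_sum_mod4 y n./2 w2; have := u4 j; rewrite SuE.
set s := \sum_(i < n./2) y i *: w i; set c := S ^+ j *m b.
rewrite dotDl ![dot _ (s + _)]dotC !dotDl !dotZl ![dot _ (_ *: _)]dotC !dotZl.
rewrite (dotC c s) => c4 s4.
have /dvdzP[q qE] : (4 %| \sum_(i < n./2) y i * dot (w i) (w i))%Z.
  move: c4 s4; set t := \sum_(_ < _) _; move: (dot s s) (dot s c) (dot c c) t.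
  by move=> *; lia.
have : (4 %| \sum_(i < n./2) (y i * dot (w i) (w i) -
             y i * walk_count S (i + j).+1.*2))%Z.
  apply: rpred_sum => i _; rewrite -mulrBr dvdz_mull // dot_exp // addnn.
  have := walk_count_even (t := (i + j).+1.*2) Ssk isT.
  by rewrite -signr_odd; case: (odd _) => /= => /dvdzP[k ->]; lia.
by rewrite sumrB qE => h; have := rpredB (dvdz_mull q (dvdzz 4)) h; rewrite subKr.
Qed.

(** By intertwining, S^j sends a row of [N] to an integral combination of rows of [N], and N N^T =
    l^2 makes its squared length a multiple of l^2. *)
Lemma scaled_similarity_norm n (S D N : 'M[int]_n) l i j :
  S^T = - S -> scaled_similarity S D N l -> (2 %| l)%N ->
  (4 %| dot (S ^+ j *m (row i N)^T) (S ^+ j *m (row i N)^T))%Z.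
Proof.
move=> Ssk [NS _ NN] l2.
have l4 : (4 %| l%:Z ^+ 2)%Z.
  by case/dvdnP: l2 => k ->; rewrite PoszM exprMn dvdz_mull.
have rowE : (S ^+ j *m (row i N)^T)^T = (-1) ^+ j *: (row i (D ^+ j) *m N).
  rewrite trmx_mul trmxK trmx_exp_skew // -scalemxAr; congr (_ *: _).
  by rewrite -!row_mul (intertwine_exp _ NS).
have colE : S ^+ j *m (row i N)^T = (-1) ^+ j *: (N^T *m (row i (D ^+ j))^T).
  by rewrite -trmx_mul -linearZ /= -rowE trmxK.
rewrite /dot rowE {1}colE -scalemxAl -scalemxAr scalerA mulmxA -(mulmxA _ N) NN.
rewrite mul_mx_scalar -!scalemxAl.
by rewrite [X in (_ %| X)%Z]mxE dvdz_mull // mxE dvdz_mulr.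
Qed.

Lemma even_level_red2_eq0 n (S D N : 'M[int]_n) (z : int) (l : nat) :
  S^T = - S -> \det (walk S) = 2 ^+ n./2 * z -> odd `|z|%N ->
  scaled_similarity S D N l -> (2 %| l)%N -> red 2 N = 0.
Proof.
move=> Ssk detW odd_z simN l2; apply/row_matrixP=> i; rewrite row0.
pose W := walk S; set r := row i (red 2 N).
(* The vector e is left out because its squared length n may be odd. *)
pose B : 'M[int]_(n./2, n) := \matrix_(k < n./2) (S ^+ k.+1 *m ones n)^T.
have mulB (c : 'rV_(n./2)) :
    c *m B = (\sum_(k < n./2) c 0 k *: (S ^+ k.+1 *m ones n))^T.
  rewrite mulmx_sum_row linear_sum; apply: eq_bigr => k _.
  by rewrite linearZ /= rowK.
pose y0 := @lift_Fp 2 1 n./2.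
have y0E c : red 2 (y0 c) = c by apply: lift_FpK.
pose y c k := if insub k is Some k' then y0 c 0 k' else 0.
have yE c (k : 'I_(n./2)) : y c k = y0 c 0 k by rewrite /y valK.
(* Used twice: u = 0 gives the independence of the rows of [B] modulo 2, and u a row of [N] shows
   that this row is even. *)
have coeff0 (c : 'rV['F_2]_(n./2)) (u b : 'cV[int]_n) :
    u^T = y0 c *m B + 2%:Z *: b^T ->
    (forall j, (4 %| dot (S ^+ j *m u) (S ^+ j *m u))%Z) -> c = 0.
  move=> uE u4; apply/rowP=> k; rewrite -(y0E c) [LHS]mxE [RHS]mxE -yE; apply/eqP.
  rewrite intr_Fp_eq0 //; apply: (walk_span_even (y := y c) Ssk detW odd_z _ u4) => //.
  rewrite -[u]trmxK uE linearD /= mulB trmxK linearZ /= trmxK; congr (_ + _).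
  by apply: eq_bigr => i' _; rewrite yE.
have Bfree : row_free (red 2 B).
  apply: inj_row_free => c cB.
  have [b bE] : exists b, y0 c *m B = 2%:Z *: b.
    by apply/red_eq0P => //; rewrite map_mxM y0E.
  apply: (coeff0 c 0 (- b^T)).
    by rewrite bE trmx0 linearN /= trmxK scalerN subrr.
  by move=> j; rewrite mulmx0 /dot trmx0 mul0mx mxE.
have BW : red 2 B *m red 2 W = 0.
  rewrite -map_mxM; apply/red_eq0P=> //; apply: dvd_mxP => k j.
  rewrite mul_walkE.
  have -> : (B *m (S ^+ j *m ones n)) k ord0 =
      dot (S ^+ k.+1 *m ones n) (S ^+ j *m ones n).
    by rewrite /dot -(rowK (fun k : 'I_(n./2) => (S ^+ k.+1 *m ones n)^T)) -row_mul [RHS]mxE.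
  by rewrite dot_exp // dvdz_mull // walk_count_even.
have corankW : (n - \rank (red 2 W) <= n./2)%N.
  apply: corank_red => //; rewrite detW dvdzE abszM abszX /=.
  by rewrite expnSr dvdn_pmul2l ?expn_gt0 // dvdn2 odd_z.
(* The n/2 independent rows of [B] lie in a kernel of dimension at most n/2. *)
have kerB : (kermx (red 2 W) <= red 2 B)%MS.
  have Bker : (red 2 B <= kermx (red 2 W))%MS by apply/sub_kermxP.
  rewrite -(mxrank_leqif_sup Bker) eqn_leq mxrankS //= mxrank_ker.
  by move: Bfree; rewrite /row_free => /eqP->.
have /submxP[c rE] : (r <= red 2 B)%MS.
  apply: submx_trans kerB; apply/sub_kermxP.
  rewrite /r -row_mul -map_mxM (scaled_similarity_walk simN).
  by rewrite red_dvdz ?row0.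
have [b bE] : exists b, row i N - y0 c *m B = 2%:Z *: b.
  by apply/red_eq0P => //; rewrite map_mxB map_mxM y0E map_row -rE subrr.
rewrite rE (coeff0 c (row i N)^T b^T) ?mul0mx //.
  by rewrite !trmxK -bE addrC subrK.
by move=> j; apply: scaled_similarity_norm simN l2.
Qed.

(** * Levels of rational matrices *)

Lemma map_intr_mx_inj m n : injective (map_mx (intr : int -> rat) : 'M_(m, n) -> 'M_(m, n)).
Proof.
move=> A B /matrixP AB; apply/matrixP=> i j; have := AB i j; rewrite !mxE.
exact: intr_inj.
Qed.

(** Otherwise the remainder of k by l would be a smaller positive multiplier clearing the
    denominators. *)
Lemma is_level_dvd n (Q : 'M[rat]_n) l k :
  is_level Q l -> integral_mx (k%:R *: Q) -> (l %| k)%N.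
Proof.
case=> l_gt0 [[A AE] l_min] [B BE]; apply: contraT => /negP l_k.
have r_gt0 : (0 < k %% l)%N by rewrite lt0n; apply/negP.
have := l_min _ r_gt0; rewrite leqNgt ltn_mod l_gt0; apply.
exists (B - (k %/ l)%N%:Z *: A); rewrite map_mxB map_mxZ -AE -BE scalerA -scalerBl.
by congr (_ *: _); rewrite {2}(divn_eq k l) natrD natrM /= -pmulrn addrAC subrr add0r.
Qed.

Lemma is_level_similarity n (S D : 'M[int]_n) (Q : 'M[rat]_n) l :
  reg_orth Q -> Q^T *m intr_mx S *m Q = intr_mx D -> is_level Q l ->
  exists2 N, scaled_similarity S D N l & map_mx intr N = l%:R *: Q^T.
Proof.
move=> [QQ Qe] QSQ [_ [[M ME] _]].
have NE : map_mx intr M^T = l%:R *: Q^T by rewrite -map_trmx -ME linearZ.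
have QQT := mulmx1C QQ.
exists M^T => //; split.
- apply: map_intr_mx_inj; rewrite !map_mxM NE -scalemxAl -scalemxAr; congr (_ *: _).
  by rewrite -/(intr_mx S) -/(intr_mx D) -QSQ -!mulmxA QQT mulmx1.
- apply: map_intr_mx_inj; rewrite map_mxM map_mxZ NE map_const_mx -scalemxAl.
  by rewrite -{1}Qe mulmxA QQ mul1mx.
apply: map_intr_mx_inj; rewrite map_mxM trmxK NE -ME -scalemxAl -scalemxAr.
by rewrite QQ scalerA map_scalar_mx rmorphXn /= -pmulrn scalemx1 -expr2.
Qed.

(** If p divided [N], then l / p would already clear the denominators of [Q]. *)
Lemma is_level_red_neq0 n (Q : 'M[rat]_n) (N : 'M[int]_n) l p :
  is_level Q l -> map_mx intr N = l%:R *: Q^T -> prime p -> (p %| l)%N ->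
  red p N != 0.
Proof.
move=> levQ NE p_pr /dvdnP[k lE]; apply/eqP => /red_eq0P -/(_ p_pr)[B BE].
have kQ : integral_mx (k%:R *: Q).
  exists B^T; rewrite -map_trmx; apply: (can_inj trmxK); rewrite trmxK linearZ /=.
  apply: (scalerI (_ : p%:R != 0 :> rat)); first by rewrite pnatr_eq0; case: (p) p_pr.
  have := NE; rewrite BE map_mxZ /= -pmulrn => ->.
  by rewrite scalerA lE natrM mulrC.
have l_gt0 : (0 < l)%N by case: levQ.
have := is_level_dvd levQ kQ; rewrite lE => /dvdn_leq.
rewrite lE muln_gt0 in l_gt0; case/andP: l_gt0 => k_gt0 _ /(_ k_gt0).
by rewrite leqNgt -{1}[k]muln1 ltn_pmul2l // prime_gt1.
Qed.

(** Multiplying N W = l W(D) by the adjugate of W shows that det W * Q^T is integral. *)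
Lemma is_level_dvd_det n (S D : 'M[int]_n) (Q : 'M[rat]_n) l :
  reg_orth Q -> Q^T *m intr_mx S *m Q = intr_mx D -> is_level Q l ->
  (l %| `|\det (walk S)|)%N.
Proof.
move=> regQ QSQ levQ; have [N simN NE] := is_level_similarity regQ QSQ levQ.
have l_neq0 : l%:R != 0 :> rat by case: levQ; rewrite pnatr_eq0 -lt0n.
have NW := scaled_similarity_walk simN.
have detQ : (\det (walk S))%:~R *: Q^T =
    map_mx intr (walk D *m \adj (walk S)).
  apply: (scalerI l_neq0); rewrite scalerA mulrC -scalerA -NE.
  have -> : l%:R = l%:Z%:~R :> rat by rewrite -pmulrn.
  rewrite -map_mxZ -map_mxZ scalemxAl -NW -mulmxA mul_mx_adj.
  by rewrite mul_mx_scalar.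
apply: (is_level_dvd levQ).
(* The sign replaces det W by its absolute value, since the multipliers in [is_level] are natural
   numbers. *)
exists (sgz (\det (walk S)) *: (walk D *m \adj (walk S))^T).
rewrite map_mxZ -map_trmx -detQ linearZ /= trmxK scalerA -intrM.
by rewrite -abszEsg.
Qed.

(** * Divisibility of the levels, prime by prime *)

Unset Implicit Arguments.

Theorem theorem1p4 (n : nat) (S : 'M[int]_n) (Q0 : 'M[rat]_n) (l0 : nat)
  (Q : 'M[rat]_n) (l : nat) :
  in_Gn S ->
  reg_orth Q0 -> Q0^T *m intr_mx S *m Q0 = intr_mx (converse S) ->
  is_level Q0 l0 ->
  in_QSigma S Q -> is_level Q l ->
  (l %| l0)%N.
Proof.
move=> [[_ Ssk] [z [detW [odd_z sqf_z]]]] reg0 sim0 lev0 [regQ [D [_ [_ simQ]]]] levQ.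
change (walk_mx S) with (walk S) in detW.
have [N0 simN0 _] := is_level_similarity reg0 sim0 lev0.
have [N simN NE] := is_level_similarity regQ simQ levQ.
have l_gt0 : (0 < l)%N by case: levQ.
have odd_l : odd l.
  apply: contraT; rewrite -dvdn2 => l2.
  have := is_level_red_neq0 levQ NE (isT : prime 2) l2.
  by rewrite (even_level_red2_eq0 Ssk detW odd_z simN) ?eqxx.
have l_z : (l %| `|z|)%N.
  have := is_level_dvd_det regQ simQ levQ.
  by rewrite detW abszM abszX Gauss_dvdr // coprimeXr // coprimen2.
(* As l divides the square-free z, its p-part is p itself, so it is enough that every prime divisor
   of l divides l0. *)
apply/dvdn_partP => // p; rewrite mem_primes => /and3P[p_pr _ p_l].
have odd_p : odd p by apply: dvdn_odd p_l odd_l.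
have p_det : ~~ ((p ^ 2)%N%:Z %| \det (walk S))%Z.
  rewrite detW dvdzE abszM abszX /= Gauss_dvdr.
    by rewrite expnS expn1; apply: sqf_z.
  by rewrite coprimeXl // coprimeXr // coprimen2.
have p_l0 : (p %| l0)%N.
  apply: (odd_prime_dvd_converse_level p_pr odd_p Ssk p_det simN simN0 p_l).
  exact: is_level_red_neq0 levQ NE p_pr p_l.
suff /eqP lp : logn p l == 1%N by rewrite p_part lp expn1.
rewrite eqn_leq -pfactor_dvdn // p_l andbT leqNgt -pfactor_dvdn //.
apply: contra (sqf_z p p_pr) => p2_l; rewrite -[(p * p)%N]/(p ^ 2)%N.
exact: dvdn_trans p2_l l_z.
Qed.
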